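(* The Petersen graph $\mathrm{P}$ has no quantum symmetry, i.e. $G_{aut}^+(\mathrm{P}) = G_{aut}(\mathrm{P}) = S_5$. Explicitly: the universal unital $C^*$-algebra $C(G_{aut}^+(\mathrm{P}))$ is commutative; equivalently, the canonical $*$-homomorphism $C(G_{aut}^+(\mathrm{P})) \to C(G_{aut}(\mathrm{P}))$ sending $u_{ij}$ to the function $\sigma \mapsto \delta_{i,\sigma(j)}$ is an isomorphism, where $G_{aut}(\mathrm{P})$ is the usual automorphism group of $\mathrm{P}$, which is isomorphic to the symmetric group $S_5$.
   Context: The Petersen graph $\mathrm{P}$ is the undirected graph (no loops, no multiple edges) on the ten vertices $o_0,\dots,o_4,p_0,\dots,p_4$ in which, with indices modulo $5$, $o_k$ is adjacent to $o_{k+1}$, $p_k$ is adjacent to $p_{k+2}$, and $o_k$ is adjacent to $p_k$, for all $k$, and there are no other adjacencies. Its vertices are relabelled $1,\dots,10$ in some fixed way. For a finite graph $\Gamma=(V,E)$ without multiple edges, with $V=\{1,\dots,n\}$, the edge set $E$ is regarded as a subset of $V\times V$ (undirected means $(i,j)\in E \Leftrightarrow (j,i)\in E$), and the adjacency matrix $\varepsilon\in M_n(\{0,1\})$ has $\varepsilon_{ij}=1$ if and only if $(i,j)\in E$. The automorphism group is $G_{aut}(\Gamma)=\{\sigma\in S_n : \sigma\varepsilon=\varepsilon\sigma\}$ (permutations viewed as permutation matrices), i.e. the group of bijections $\sigma:V\to V$ with $(\sigma(i),\sigma(j))\in E \Leftrightarrow (i,j)\in E$. $C(G_{aut}(\Gamma))$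 denotes the algebra of complex-valued functions on this finite group. A compact matrix quantum group is a pair $(C(G),u)$, where $C(G)$ is a unital $C^*$-algebra generated by the entries $u_{ij}$ of a matrix $u\in M_n(C(G))$, such that the $*$-homomorphism $\Delta:C(G)\to C(G)\otimes C(G)$, $u_{ij}\mapsto\sum_k u_{ik}\otimes u_{kj}$ exists and $u$ and its transpose $u^t$ are invertible. Banica's quantum automorphism group $G_{aut}^+(\Gamma)$ is the compact matrix quantum group $(C(G_{aut}^+(\Gamma)),u)$, where $C(G_{aut}^+(\Gamma))$ is the universal unital $C^*$-algebra with generators $u_{ij}$, $1\le i,j\le n$, and relations $u_{ij}=u_{ij}^*$, $u_{ij}u_{ik}=\delta_{jk}u_{ij}$, $u_{ji}u_{ki}=\delta_{jk}u_{ji}$ for all $1\le i,j,k\le n$; $\sum_{l=1}^n u_{il}=1=\sum_{l=1}^n u_{li}$ for all $1\le i\le n$; and $u\varepsilon=\varepsilon u$, i.e. $\sum_k u_{ik}\varepsilon_{kj}=\sum_k\varepsilon_{ik}u_{kj}$ for all $i,j$. A finite graph $\Gamma$ is said to have no quantum symmetry if $C(G_{aut}^+(\Gamma))$ is commutative, or equivalently $C(G_{aut}^+(\Gamma))=C(G_{aut}(\Gamma))$ via the canonical map above. *)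

(* Defs.v *)
From HB Require Import structures.
From mathcomp Require Import all_boot all_order all_fingroup all_algebra.
From mathcomp Require Import complex.
From mathcomp Require Import boolp classical_sets reals topology normedtype.
From mathcomp Require Import sequences.

Set Implicit Arguments.
Unset Strict Implicit.
Unset Printing Implicit Defensive.

Import Order.TTheory GRing.Theory Num.Theory Normc.
Import numFieldNormedType.Exports.

Local Open Scope ring_scope.
Local Open Scope complex_scope.
Local Open Scope classical_set_scope.

Section NormConvergence.
Variables (R : realType) (V : zmodType) (N : V -> R).

Definition norm_cauchy (s : nat -> V) : Prop :=
  forall eps : R, 0 < eps -> \forall m & n \near \oo, N (s m - s n) < eps.

Definition norm_cvg (s : nat -> V) (l : V) : Prop :=
  N (s n - l) @[n --> \oo] --> (0 : R).

End NormConvergence.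

(* Unital complex C*-algebras.  The norm is a field of the mixin because the
   hierarchy has no join of [normedModType] with non-commutative rings.
   As [algType] extends [nzRingType], the zero algebra is not a [cstarAlgType];
   universal properties are not affected, every unital C*-algebra having
   exactly one unital *-homomorphism to it. *)
HB.mixin Record Algebra_isCStarAlgebra (R : realType) A
    of GRing.Algebra R[i] A := {
  star : A -> A;
  cnorm : A -> R;
  starK : involutive star;
  starD : {morph star : x y / x + y};
  starZ : forall (a : R[i]) (x : A), star (a *: x) = a^* *: star x;
  starM : forall x y : A, star (x * y) = star y * star x;
  cnorm_eq0 : forall x : A, cnorm x = 0 -> x = 0;
  cnormD : forall x y : A, cnorm (x + y) <= cnorm x + cnorm y;
  cnormZ : forall (a : R[i]) (x : A), cnorm (a *: x) = normc a * cnorm x;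
  cnormM : forall x y : A, cnorm (x * y) <= cnorm x * cnorm y;
  cnorm_starM : forall x : A, cnorm (star x * x) = cnorm x ^+ 2;
  cnorm_complete : forall s : nat -> A,
    norm_cauchy cnorm s -> exists l : A, norm_cvg cnorm s l
}.

#[short(type="cstarAlgType")]
HB.structure Definition CStarAlgebra (R : realType) :=
  {A of GRing.Algebra R[i] A & Algebra_isCStarAlgebra R A}.

Section StarHom.
Variables (R : realType) (A B : cstarAlgType R).

(* Ring morphisms preserve 1, so these are the unital *-homomorphisms. *)
Definition star_hom (phi : {lrmorphism A -> B}) : Prop :=
  {morph phi : x / star x}.

Definition star_hom_on n (u : 'M[A]_n) (v : 'M[B]_n)
    (phi : {lrmorphism A -> B}) : Prop :=
  star_hom phi /\ forall i j, phi (u i j) = v i j.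

End StarHom.

(* [S] is a norm-closed unital *-subalgebra. *)
Record cstar_subalgebra (R : realType) (A : cstarAlgType R) (S : set A) : Prop :=
  CStarSubalgebra {
  cstar_sub1 : S 1;
  cstar_subD : forall x y, S x -> S y -> S (x + y);
  cstar_subZ : forall (a : R[i]) x, S x -> S (a *: x);
  cstar_subM : forall x y, S x -> S y -> S (x * y);
  cstar_sub_star : forall x, S x -> S (star x);
  cstar_sub_closed : forall s l,
    (forall n, S (s n)) -> norm_cvg (@cnorm R A) s l -> S l
}.

Definition cstar_generated (R : realType) (A : cstarAlgType R) n
    (u : 'M[A]_n) : Prop :=
  forall S : set A,
    cstar_subalgebra S -> (forall i j, S (u i j)) -> S = [set: A].

(* The C*-algebra C(X) with the sup norm; X is a finite group so as to be
   non-empty. *)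
Definition cfun (R : realType) (X : finGroupType) : Type := {ffun X -> R[i]}.

Section FunctionAlgebra.
Variables (R : realType) (X : finGroupType).
Local Notation C := (cfun R X).
Local Notation Re := (@complex.Re R).
Local Notation Im := (@complex.Im R).
Implicit Types f g : C.

HB.instance Definition _ := GRing.Lmodule.on C.
HB.instance Definition _ := GRing.PzRing.on C.

Fact cfun_oner_neq0 : (1 : C) != 0.
Proof. exact: ffun1_nonzero (1%g : X). Qed.
HB.instance Definition _ := GRing.PzSemiRing_isNonZero.Build C cfun_oner_neq0.

Fact cfun_scalerAl (a : R[i]) f g : a *: (f * g) = (a *: f) * g.
Proof. by apply/ffunP => x; rewrite !ffunE; exact: mulrA. Qed.
HB.instance Definition _ := GRing.LSemiModule_isLSemiAlgebra.Build R[i] C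
  cfun_scalerAl.

Fact cfun_scalerAr (a : R[i]) f g : a *: (f * g) = f * (a *: g).
Proof. by apply/ffunP => x; rewrite !ffunE; exact: mulrCA. Qed.
HB.instance Definition _ := GRing.LSemiAlgebra_isSemiAlgebra.Build R[i] C
  cfun_scalerAr.

Definition cfun_star f : C := [ffun x => (f x)^*].
Definition cfun_norm f : R := \big[Num.max/0]_(x : X) normc (f x).

Fact cfun_starK : involutive cfun_star.
Proof. by move=> f; apply/ffunP => x; rewrite !ffunE conjcK. Qed.
Fact cfun_starD : {morph cfun_star : f g / f + g}.
Proof. by move=> f g; apply/ffunP => x; rewrite !ffunE rmorphD. Qed.
Fact cfun_starZ (a : R[i]) f : cfun_star (a *: f) = a^* *: cfun_star f.
Proof. by apply/ffunP => x; rewrite !ffunE [LHS]rmorphM. Qed.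
Fact cfun_starM f g : cfun_star (f * g) = cfun_star g * cfun_star f.
Proof. by apply/ffunP => x; rewrite !ffunE rmorphM mulrC. Qed.

Lemma normc_ge0 (z : R[i]) : 0 <= normc z.
Proof. by case: z => a b; apply: sqrtr_ge0. Qed.

Lemma cfun_norm_le f (a : R) :
  (cfun_norm f <= a) <-> 0 <= a /\ forall x, normc (f x) <= a.
Proof.
rewrite /cfun_norm; split => [fa|[a0 fa]].
  split=> [|x]; apply: le_trans fa; first exact: bigmax_ge_id.
  exact: (le_bigmax_cond _ (fun x => normc (f x))).
by apply: bigmax_le.
Qed.

Lemma cfun_norm_ge0 f : 0 <= cfun_norm f.
Proof. exact: bigmax_ge_id. Qed.

Lemma cfun_norm_ge f x : normc (f x) <= cfun_norm f.
Proof. by have /cfun_norm_le[_] := lexx (cfun_norm f). Qed.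

Fact cfun_norm_eq0 f : cfun_norm f = 0 -> f = 0.
Proof.
move=> f0; apply/ffunP => x; rewrite ffunE; apply: eq0_normc.
by apply/eqP; rewrite eq_le normc_ge0 -f0 cfun_norm_ge.
Qed.

Fact cfun_normD f g : cfun_norm (f + g) <= cfun_norm f + cfun_norm g.
Proof.
apply/cfun_norm_le; split=> [|x]; first by rewrite addr_ge0 ?cfun_norm_ge0.
by rewrite ffunE (le_trans (le_normcD _ _))// lerD ?cfun_norm_ge.
Qed.

Fact cfun_normM f g : cfun_norm (f * g) <= cfun_norm f * cfun_norm g.
Proof.
apply/cfun_norm_le; split=> [|x]; first by rewrite mulr_ge0 ?cfun_norm_ge0.
by rewrite ffunE normcM ler_pM ?cfun_norm_ge ?normc_ge0.
Qed.

Lemma cfun_norm_attained f : exists x, cfun_norm f = normc (f x).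
Proof.
pose y := [arg max_(x > (1%g : X)) normc (f x)]%O; exists y.
apply/eqP; rewrite eq_le cfun_norm_ge andbT; apply/cfun_norm_le.
split=> [|x]; first exact: normc_ge0.
by rewrite /y; case: arg_maxP => // z _; apply.
Qed.

Fact cfun_normZ (a : R[i]) f : cfun_norm (a *: f) = normc a * cfun_norm f.
Proof.
apply/eqP; rewrite eq_le; apply/andP; split.
  apply/cfun_norm_le; split=> [|x].
    by rewrite mulr_ge0 ?cfun_norm_ge0 ?normc_ge0.
  by rewrite ffunE [X in X <= _]normcM ler_wpM2l ?cfun_norm_ge ?normc_ge0.
have [x ->] := cfun_norm_attained f; rewrite -normcM.
by apply: le_trans (cfun_norm_ge _ x); rewrite ffunE.
Qed.

Lemma normc_conj (z : R[i]) : normc z^* = normc z.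
Proof. by case: z => a b /=; rewrite sqrrN. Qed.

Fact cfun_norm_starM f : cfun_norm (cfun_star f * f) = cfun_norm f ^+ 2.
Proof.
apply/eqP; rewrite eq_le; apply/andP; split.
  apply/cfun_norm_le; split=> [|x]; first by rewrite sqr_ge0.
  by rewrite !ffunE normcM normc_conj ler_pM ?cfun_norm_ge ?normc_ge0.
have [x ->] := cfun_norm_attained f.
by apply: le_trans (cfun_norm_ge _ x); rewrite !ffunE normcM normc_conj.
Qed.

Lemma normc_ge_Re_Im (z : R[i]) :
  `|Re z| <= normc z /\ `|Im z| <= normc z.
Proof.
case: z => a b /=.
by split; rewrite -[leLHS]sqrtr_sqr ler_wsqrtr// ?lerDl ?lerDr sqr_ge0.
Qed.

Lemma normc_le_ReIm (z : R[i]) : normc z <= `|Re z| + `|Im z|.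
Proof.
case: z => a b /=; rewrite -[leRHS]ger0_norm ?addr_ge0//.
rewrite -sqrtr_sqr ler_wsqrtr// sqrrD !real_normK ?num_real//.
by rewrite lerD2r lerDl mulrn_wge0 ?mulr_ge0.
Qed.

Fact cfun_complete (s : nat -> C) :
  norm_cauchy cfun_norm s -> exists l : C, norm_cvg cfun_norm s l.
Proof.
move=> s_cauchy.
have part_cvg (p : R[i] -> R) : {morph p : z w / z - w} ->
    (forall z, `|p z| <= normc z) ->
    forall x, cvg ((fun n => p (s n x)) @ \oo).
  move=> pB p_le x; apply: R_complete; apply/cauchy_ballP => eps eps0.
  case: (s_cauchy _ eps0) => -[P Q] [/= P_near Q_near] PQ.
  exists ((fun n => p (s n x)) @` P, (fun n => p (s n x)) @` Q).
    split => /=.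
      by apply: filterS P_near => n Pn; exists n.
    by apply: filterS Q_near => n Qn; exists n.
  move=> [_ _] [/= [m Pm <-] [n Qn <-]].
  have /= := PQ (m, n) (conj Pm Qn).
  apply: le_lt_trans; rewrite -pB (le_trans (p_le _))//.
  by have := cfun_norm_ge (s m - s n) x; rewrite !ffunE.
have Re_cvg := part_cvg _ (@raddfB _ _ Re) (fun z => (normc_ge_Re_Im z).1).
have Im_cvg := part_cvg _ (@raddfB _ _ Im) (fun z => (normc_ge_Re_Im z).2).
exists [ffun x => lim ((fun n => Re (s n x)) @ \oo)
                  +i* lim ((fun n => Im (s n x)) @ \oo)].
apply/cvgrPdist_le => /= eps eps0.
have eps20 : 0 < eps / 2 by rewrite divr_gt0.
have near_x : \forall n \near \oo, forall x : X,
    `|lim ((fun n => Re (s n x)) @ \oo) - Re (s n x)| <= eps / 2 /\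
    `|lim ((fun n => Im (s n x)) @ \oo) - Im (s n x)| <= eps / 2.
  apply: filter_forall => x; near=> n; split; near: n.
    by have /cvgrPdist_le := Re_cvg x; apply.
  by have /cvgrPdist_le := Im_cvg x; apply.
apply: filterS near_x => n near_x.
rewrite sub0r normrN ger0_norm ?cfun_norm_ge0//.
apply/cfun_norm_le; split=> [|x]; first exact: ltW.
rewrite !ffunE (le_trans (normc_le_ReIm _))// [leRHS]splitr.
have [Re_le Im_le] := near_x x.
by rewrite !raddfB /= lerD// distrC.
Unshelve. all: by end_near. Qed.

HB.instance Definition _ := Algebra_isCStarAlgebra.Build R C
  cfun_starK cfun_starD cfun_starZ cfun_starM
  cfun_norm_eq0 cfun_normD cfun_normZ cfun_normM cfun_norm_starM cfun_complete.

End FunctionAlgebra.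

(* A finite graph on {1, ..., n} is given by its edge relation
   [e : rel 'I_n]; vertex number k + 1 is the ordinal k. *)

Definition adjacency_mx (K : pzRingType) n (e : rel 'I_n) : 'M[K]_n :=
  \matrix_(i, j) (e i j)%:R.

Section ClassicalAut.
Variables (n : nat) (e : rel 'I_n).

Definition Gaut_set : {set 'S_n} :=
  [set s | perm_mx s *m adjacency_mx int e == adjacency_mx int e *m perm_mx s].

Fact Gaut_group_set : group_set Gaut_set.
Proof.
apply/group_setP; split=> [|s t]; first by rewrite inE perm_mx1 mul1mx mulmx1.
rewrite !inE perm_mxM => /eqP es /eqP et.
by rewrite -mulmxA et mulmxA es mulmxA.
Qed.

Canonical Gaut : {group 'S_n} := Group Gaut_group_set.

Lemma mem_GautP (s : 'S_n) :
  reflect (forall i j, e (s i) (s j) = e i j) (s \in Gaut).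
Proof.
have mxE1 i j : (perm_mx s *m adjacency_mx int e) i j = (e (s i) j)%:R.
  rewrite mxE (bigD1 (s i))//= big1 ?addr0 => [|k /negPf ki].
    by rewrite !mxE eqxx mul1r.
  by rewrite !mxE eq_sym ki mul0r.
have mxE2 i j : (adjacency_mx int e *m perm_mx s) i (s j) = (e i j)%:R.
  rewrite mxE (bigD1 j)//= big1 ?addr0 => [|k /negPf kj].
    by rewrite !mxE eqxx mulr1.
  by rewrite !mxE (inj_eq perm_inj) kj mulr0.
rewrite inE; apply: (iffP eqP) => [/matrixP es i j|es].
  by have := es i (s j); rewrite mxE1 mxE2; do 2!case: (e _ _).
by apply/matrixP => i j; rewrite -(permKV s j) mxE1 mxE2 es.
Qed.

End ClassicalAut.

Section QuantumAut.
Variables (R : realType) (n : nat) (e : rel 'I_n).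

Record qaut_relations (A : cstarAlgType R) (u : 'M[A]_n) : Prop :=
  QautRelations {
  qaut_self_adjoint : forall i j, u i j = star (u i j);
  qaut_row_orthogonal : forall i j k, u i j * u i k = (j == k)%:R * u i j;
  qaut_col_orthogonal : forall i j k, u j i * u k i = (j == k)%:R * u j i;
  qaut_row_sum : forall i, \sum_l u i l = 1;
  qaut_col_sum : forall i, \sum_l u l i = 1;
  qaut_adjacency : u *m adjacency_mx A e = adjacency_mx A e *m u
}.

(* [(A, u)] is C(G_aut^+) with its generators.  The universal C*-algebra is
   specified by its universal property, hence up to unique isomorphism. *)
Record is_qaut_algebra (A : cstarAlgType R) (u : 'M[A]_n) : Prop :=
  IsQautAlgebra {
  qaut_algebra_relations : qaut_relations u;
  qaut_algebra_generated : cstar_generated u;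
  qaut_algebra_universal :
    forall (B : cstarAlgType R) (v : 'M[B]_n), qaut_relations v ->
      exists2 phi : {lrmorphism A -> B}, star_hom_on u v phi &
        forall psi : {lrmorphism A -> B}, star_hom_on u v psi -> psi =1 phi
}.

Definition no_quantum_symmetry : Prop :=
  forall (A : cstarAlgType R) (u : 'M[A]_n),
    is_qaut_algebra u -> commutative (@GRing.mul A).

(* The entries of the fundamental representation of G_aut:
   u i j = (s |-> delta_(i, s j)). *)
Definition Gaut_fundamental : 'M[cfun R (subg_of (Gaut e))]_n :=
  \matrix_(i, j) [ffun s : subg_of (Gaut e) =>
                     (i == (sgval s : 'S_n) j)%:R].

Lemma Gaut_fundamental_relations : qaut_relations Gaut_fundamental.
Proof.
split=> [i j|i j k|i j k|i|i|].
- apply/ffunP => s; rewrite !mxE !ffunE.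
  by case: eqP; rewrite /= ?oppr0.
- apply/ffunP => s; rewrite !mxE.
  have [<-|/negPf jk] := eqVneq j k; rewrite ?mul1r ?mul0r !ffunE.
    by case: eqP; rewrite ?mulr1 ?mulr0.
  case: eqP => [->|_]; rewrite ?mul0r ?mul1r//.
  by rewrite (inj_eq perm_inj) jk.
- apply/ffunP => s; rewrite !mxE.
  have [<-|/negPf jk] := eqVneq j k; rewrite ?mul1r ?mul0r !ffunE.
    by case: eqP; rewrite ?mulr1 ?mulr0.
  by case: eqP => [<-|_]; rewrite ?mul0r ?mul1r// eq_sym jk.
- apply/ffunP => s; rewrite sum_ffunE.
  rewrite (bigD1 ((sgval s : 'S_n)^-1%g i))//= big1 => [|k ki].
    by rewrite !mxE !ffunE permKV eqxx addr0.
  by rewrite !mxE !ffunE; case: eqP => // ik; rewrite ik permK eqxx in ki.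
- apply/ffunP => s; rewrite sum_ffunE.
  rewrite (bigD1 ((sgval s : 'S_n) i))//= big1 => [|k /negPf ki].
    by rewrite !mxE !ffunE eqxx addr0.
  by rewrite !mxE !ffunE ki.
- apply/matrixP => i j; rewrite !mxE; apply/ffunP => s; rewrite !sum_ffunE.
  have cst (b : bool) : (b%:R : cfun R (subg_of (Gaut e))) s = b%:R.
    by case: b; rewrite ffunE.
  rewrite (bigD1 ((sgval s : 'S_n)^-1%g i))//= big1 => [|k ki]; last first.
    rewrite !mxE !ffunE; case: eqP => [ik|]; rewrite ?mul0r//.
    by rewrite ik permK eqxx in ki.
  rewrite (bigD1 ((sgval s : 'S_n) j))//= [X in _ = _ + X]big1.
    rewrite !mxE !ffunE !cst !permKV !eqxx !addr0 mul1r mulr1.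
    by rewrite -(elimT (mem_GautP e (sgval s)) (subgP s)) permKV.
  by move=> k /negPf ki; rewrite !mxE !ffunE ki mulr0.
Qed.

End QuantumAut.

(* [inl k] is the outer vertex o_k and [inr k] the inner vertex p_k. *)
Definition petersen_vertex : finType := ('Z_5 + 'Z_5)%type.

Definition petersen_adj : rel petersen_vertex := fun x y =>
  match x, y with
  | inl i, inl j => (j == i + 1) || (i == j + 1)
  | inr i, inr j => (j == i + 2) || (i == j + 2)
  | inl i, inr j | inr i, inl j => i == j
  end.

(* Main.v *)
From HB Require Import structures.
Require Import Defs.
From mathcomp Require Import all_boot all_order all_fingroup all_algebra.
From mathcomp Require Import complex reals.

Set Implicit Arguments.
Unset Strict Implicit.
Unset Printing Implicit Defensive.

Import GRing.Theory.

Local Open Scope ring_scope.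

(** The Petersen graph has no quadrangle, all its vertices have degree three,
    and any two distinct nonadjacent vertices have a common neighbour.  For
    every graph with maximum degree at most three and the other two properties,
    the entries of a matrix [u] satisfying the relations of the quantum
    automorphism group commute ([qaut_entries_comm]).  As the entries are
    projections, it is enough to show
      [u i j * u k l * u i m = 0]  for  [m != j],
    since summing over [m] then gives [u i j * u k l = u i j * u k l * u i j],
    which is self-adjoint.

    An entry [u i j] annihilates [u k l] unless the pairs [i, k] and [j, l] are
    of the same kind: both equal, both edges, or both distinct and nonadjacent.
    If they are edges, one may assume that [m] is a neighbour of [l].  Then
    [u k l] may be replaced in the triple product by [\sum_a u k a = 1]: the
    extra terms vanish unless [a] is a common neighbour of [j] and [m], and [l]
    is the only one.  If they are distinct and nonadjacent, let [t] and [s] be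
    the common neighbours of [i, k] and of [j, l].  By the same replacement,
    [u i j * u k l = u i j * u t s * u k l], where [u t s] commutes with both
    factors by the case of edges.  The triple product vanishes unless [m] is
    also a neighbour of [s]; then [j, l, m] are all the neighbours of [s], and
    the product is [u i j * u t s * u k l * u i m], in which [u k l] may once
    more be replaced by 1.

    As soon as the entries always commute, the function algebra of the classical
    automorphism group has the universal property: given commuting entries [v],
    the function [f] is sent to the sum over the automorphisms [s] of
    [f s *: \prod_j v (s j) j], these products being pairwise orthogonal
    projections of sum 1 ([cfun_is_qaut_algebra]).  Any universal algebra is
    then isomorphic to it ([qaut_algebra_iso_cfun]), hence commutative.

    For the last claim, the vertices are labelled by the pairs of elements of
    Z/5 so that adjacency is disjointness; this gives an injection of S_5 into
    the automorphism group.  An automorphism is determined by the image of a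
    directed path with three edges, and there are 120 such paths, so the
    injection is onto ([petersen_aut_isog]). *)

(** * Generalities on star-algebras and products *)

Section StarAlgebra.
Variables (R : realType) (A : cstarAlgType R).

Lemma star1 : star (1 : A) = 1.
Proof. by rewrite -[LHS]mulr1 -{2}[1]starK -starM mulr1 starK. Qed.

Lemma star0 : star (0 : A) = 0.
Proof. by apply: (addrI (star 0)); rewrite -starD !addr0. Qed.

Lemma star_sum (I : Type) (r : seq I) (F : I -> A) :
  star (\sum_(i <- r) F i) = \sum_(i <- r) star (F i).
Proof. exact: (big_morph _ (@starD _ _) star0). Qed.

Lemma star_prod_comm (I : Type) (r : seq I) (F : I -> A) :
    (forall i, star (F i) = F i) ->
    (forall i j, GRing.comm (F i) (F j)) ->
  star (\prod_(i <- r) F i) = \prod_(i <- r) F i.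
Proof.
move=> Fstar Fcomm; elim: r => [|i r IHr]; first by rewrite big_nil star1.
rewrite big_cons starM IHr Fstar; apply/commr_sym.
exact: commr_prod.
Qed.

End StarAlgebra.

Lemma mulr_prod_absorb (A : nzRingType) (I : eqType) (r : seq I) (F : I -> A)
    (i : I) :
    i \in r -> F i * F i = F i -> (forall j, GRing.comm (F i) (F j)) ->
  F i * \prod_(j <- r) F j = \prod_(j <- r) F j.
Proof.
move=> ir Fii Fcomm; elim: r ir => // j r IHr; rewrite inE big_cons.
have [<-|_] /= := eqVneq i j; first by rewrite mulrA Fii.
by move=> /IHr Fr; rewrite mulrA Fcomm -mulrA Fr.
Qed.

(** * Commutation of the entries of a quantum automorphism matrix *)

Section Relations.
Variables (R : realType) (n : nat) (e : rel 'I_n).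
Variables (A : cstarAlgType R) (u : 'M[A]_n).
Hypothesis urel : qaut_relations e u.

Lemma qaut_idem i j : u i j * u i j = u i j.
Proof. by rewrite (qaut_row_orthogonal urel) eqxx mul1r. Qed.

Lemma qaut_row0 i j k : j != k -> u i j * u i k = 0.
Proof. by rewrite (qaut_row_orthogonal urel) => /negPf->; rewrite mul0r. Qed.

Lemma qaut_col0 i j k : i != j -> u i k * u j k = 0.
Proof. by rewrite (qaut_col_orthogonal urel) => /negPf->; rewrite mul0r. Qed.

(** Both sides of the matrix identity between [u] and the adjacency matrix are
    compared after multiplication by [u i j] on the left and [u k l] on the
    right. *)
Lemma qaut_adj0 i j k l : e i k != e j l -> u i j * u k l = 0.
Proof.
move=> eikjl.
have := congr1 (fun M : 'M_n => u i j * M i l * u k l) (qaut_adjacency urel).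
have -> : u i j * (u *m adjacency_mx A e) i l * u k l =
          (e j l)%:R * (u i j * u k l).
  rewrite mxE mulr_sumr (bigD1 j)//= big1 => [|m mj].
    by rewrite addr0 mxE mulrA qaut_idem commr_nat mulrA.
  by rewrite mulrA qaut_row0 ?mul0r// eq_sym.
have -> : u i j * (adjacency_mx A e *m u) i l * u k l =
          (e i k)%:R * (u i j * u k l).
  rewrite mxE -mulrA mulr_suml (bigD1 k)//= big1 => [|m mk].
    by rewrite addr0 mxE -mulrA qaut_idem mulrA commr_nat mulrA.
  by rewrite -mulrA qaut_col0 ?mulr0.
by case: (e i k) (e j l) eikjl => [] []//= _; rewrite mul0r mul1r.
Qed.

(** An entry of row [i] can be replaced by the sum 1 of that row, provided that
    the other entries contribute nothing. *)
Lemma qaut_insert i j (x y : A) :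
  (forall k, k != j -> x * u i k * y = 0) -> x * u i j * y = x * y.
Proof.
move=> xy0; rewrite -[in RHS](mulr1 x) -(qaut_row_sum urel i).
by rewrite mulr_sumr mulr_suml (bigD1 j)//= big1 ?addr0.
Qed.

Lemma qaut_comm_of_absorb i j k l :
  (forall m, m != j -> u i j * u k l * u i m = 0) ->
  GRing.comm (u i j) (u k l).
Proof.
move=> absorb.
have ukl : u i j * u k l * u i j = u i j * u k l.
  rewrite -[_ * u i j]mulr1 qaut_insert ?mulr1// => m /absorb->.
  by rewrite mul0r.
(* The product is equal to a self-adjoint one; taking adjoints concludes. *)
have := congr1 (@star _ A) ukl; rewrite !starM -!(qaut_self_adjoint urel).
by rewrite mulrA ukl.
Qed.

Section NoQuadrangle.
Hypothesis no_quad : forall x y z t,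
  x != y -> e z x -> e z y -> e t x -> e t y -> z = t.
Hypothesis e_sym : symmetric e.

Lemma qaut_comm_adj i j k l :
  e i k -> e j l -> GRing.comm (u i j) (u k l).
Proof.
move=> eik ejl; apply: qaut_comm_of_absorb => m mj.
have [elm|nelm] := boolP (e l m); last first.
  by rewrite -mulrA [_ * u i m]qaut_adj0 ?mulr0// e_sym eik (negPf nelm).
rewrite qaut_insert ?qaut_row0// 1?eq_sym// => a al.
have [eja|neja] := boolP (e j a); last first.
  by rewrite qaut_adj0 ?mul0r// eik (negPf neja).
rewrite -mulrA [_ * u i m]qaut_adj0 ?mulr0//.
rewrite (e_sym k) eik eq_sym eqb_id; apply: contra al => eam.
by apply/eqP/(@no_quad j m); rewrite // 1?eq_sym // e_sym.
Qed.

Hypothesis common_nbr : forall x y,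
  x != y -> ~~ e x y -> exists2 z, e x z & e z y.
(* A vertex adjacent to three distinct vertices has no other neighbour. *)
Hypothesis subcubic : forall x y0 y1 y2 y3,
  uniq [:: y0; y1; y2] -> all (e x) [:: y0; y1; y2; y3] ->
  y3 \in [:: y0; y1; y2].

(** The entry indexed by the common neighbours of [i], [k] and of [j], [l]
    can be inserted between the entries [(i, j)] and [(k, l)]. *)
Lemma qaut_common_nbr i j k l t s : i != k -> j != l ->
    e i t -> e t k -> e j s -> e s l ->
  u i j * u t s * u k l = u i j * u k l.
Proof.
move=> ik jl eit etk ejs esl; apply: qaut_insert => a as_.
have [eja|neja] := boolP (e j a); last first.
  by rewrite qaut_adj0 ?mul0r// eit (negPf neja).
rewrite -mulrA [_ * u k l]qaut_adj0 ?mulr0//.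
rewrite etk eq_sym eqb_id; apply: contra as_ => eal.
by apply/eqP/(@no_quad j l); rewrite // e_sym.
Qed.

Lemma qaut_comm_nonadj i j k l : i != k -> j != l -> ~~ e i k -> ~~ e j l ->
  GRing.comm (u i j) (u k l).
Proof.
move=> ik jl neik nejl; apply: qaut_comm_of_absorb => p pj.
have [t eit etk] := common_nbr ik neik.
have [s ejs esl] := common_nbr jl nejl.
have uts_ij : GRing.comm (u t s) (u i j) by apply: qaut_comm_adj; rewrite e_sym.
have uts_kl : GRing.comm (u t s) (u k l) by apply: qaut_comm_adj.
rewrite -(qaut_common_nbr ik jl eit etk ejs esl).
have [<-|lp] := eqVneq l p; first by rewrite -mulrA qaut_col0 ?mulr0// eq_sym.
have [elp|nelp] := boolP (e l p).
  by rewrite -mulrA [u k l * _]qaut_adj0 ?mulr0// e_sym (negPf neik) elp.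
have [q elq eqp] := common_nbr lp nelp.
have [qs|qs] := eqVneq q s; last first.
  (* Orthogonality in row [t], of [u t s] (from [j], [l]) and [u t q]
     (from [l], [p]). *)
  have utq_kl : GRing.comm (u k l) (u t q).
    by apply: qaut_comm_adj; rewrite // e_sym.
  have ki : k != i by rewrite eq_sym.
  have ekt : e k t by rewrite e_sym.
  have eti : e t i by rewrite e_sym.
  rewrite -mulrA -(qaut_common_nbr ki lp ekt eti elq eqp) utq_kl.
  by rewrite -!mulrA [u t s * _]mulrA qaut_row0 1?eq_sym// mul0r mulr0.
(* From here on, [j], [l] and [p] are the three neighbours of [s]. *)
rewrite {q}qs in elq eqp.
rewrite qaut_insert => [|b bl].
  by rewrite -uts_ij -mulrA qaut_row0 ?mulr0// eq_sym.
have [->|bj] := eqVneq b j.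
  by rewrite -uts_ij -(mulrA (u t s)) qaut_col0// mulr0 mul0r.
have [->|bp] := eqVneq b p; first by rewrite -mulrA qaut_col0 ?mulr0// eq_sym.
rewrite -(mulrA (u i j)) qaut_adj0 ?mulr0 ?mul0r// etk eq_sym eqb_id.
apply/negP => esb.
have := @subcubic s j l p b.
rewrite /= !inE (negPf bj) (negPf bl) (negPf bp) (negPf jl) lp (eq_sym j).
by rewrite (negPf pj) (e_sym s j) ejs esl eqp esb => /(_ isT isT).
Qed.

Lemma qaut_entries_comm i j k l : GRing.comm (u i j) (u k l).
Proof.
have [<-|ik] := eqVneq i k.
  have [<-//|jl] := eqVneq j l.
  by rewrite /GRing.comm !qaut_row0// eq_sym.
have [<-|jl] := eqVneq j l; first by rewrite /GRing.comm !qaut_col0// eq_sym.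
have [eikjl|eikjl] := eqVneq (e i k) (e j l); last first.
  by rewrite /GRing.comm !qaut_adj0// !(e_sym k, e_sym l).
have [eik|neik] := boolP (e i k).
  by apply: qaut_comm_adj; rewrite -?eikjl.
by apply: qaut_comm_nonadj; rewrite -?eikjl.
Qed.

End NoQuadrangle.
End Relations.

(** * Graphs whose quantum automorphism matrices have commuting entries *)

Section Commuting.
Variables (R : realType) (n : nat) (e : rel 'I_n).
Local Notation G := (subg_of (Gaut e)).
Local Notation C := (cfun R G).

Lemma subg_neqP (s t : G) :
  s != t -> exists j, (sgval s : 'S_n) j != (sgval t : 'S_n) j.
Proof.
move=> st; apply/existsP; apply: contraR st => /existsPn st.
by apply/eqP/val_inj/permP => j; apply/eqP; rewrite -[_ == _]negbK st.
Qed.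

Section Projections.
Variables (B : cstarAlgType R) (v : 'M[B]_n).
Hypothesis vrel : qaut_relations e v.
Hypothesis vcomm : forall i j k l, GRing.comm (v i j) (v k l).

(** When the entries of [v] commute, the projection onto the event that vertex
    [j] is sent to [f j] for all [j].  It is nonzero only if [f] is an automorphism
    of the graph. *)
Definition qaut_proj (f : 'I_n -> 'I_n) : B := \prod_j v (f j) j.

Lemma eq_qaut_proj f g : f =1 g -> qaut_proj f = qaut_proj g.
Proof. by move=> fg; apply: eq_bigr => j _; rewrite fg. Qed.

Lemma qaut_proj_absorb f j : v (f j) j * qaut_proj f = qaut_proj f.
Proof.
apply: (mulr_prod_absorb (F := fun k => v (f k) k)) => //.
- by rewrite mem_index_enum.
- exact: qaut_idem vrel _ _.
Qed.

Lemma mul_entry_qaut_proj i j f :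
  v i j * qaut_proj f = (i == f j)%:R * qaut_proj f.
Proof.
have [->|ifj] := eqVneq i (f j); first by rewrite qaut_proj_absorb mul1r.
by rewrite mul0r -(qaut_proj_absorb f j) mulrA (qaut_col0 vrel) ?mul0r.
Qed.

Lemma star_qaut_proj f : star (qaut_proj f) = qaut_proj f.
Proof.
by apply: star_prod_comm => // j; rewrite -(qaut_self_adjoint vrel).
Qed.

Lemma qaut_proj_orthogonal f g j : f j != g j -> qaut_proj f * qaut_proj g = 0.
Proof.
move=> fgj; rewrite -(qaut_proj_absorb f j).
have -> : v (f j) j * qaut_proj f = qaut_proj f * v (f j) j.
  exact: commr_prod.
by rewrite -mulrA mul_entry_qaut_proj (negPf fgj) mul0r mulr0.
Qed.

Lemma qaut_proj_idem f : qaut_proj f * qaut_proj f = qaut_proj f.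
Proof.
rewrite {1}/qaut_proj; elim: (index_enum _) => [|j r IHr].
  by rewrite big_nil mul1r.
by rewrite big_cons -mulrA IHr qaut_proj_absorb.
Qed.

Lemma qaut_proj_neq0_inj f : qaut_proj f != 0 -> injective f.
Proof.
move=> /eqP f0 j k fjk; apply/eqP; apply: contra_notT f0 => jk.
rewrite -(qaut_proj_absorb f k) -(qaut_proj_absorb f j) -fjk mulrA.
by rewrite (qaut_row0 vrel) ?mul0r// eq_sym.
Qed.

Lemma qaut_proj_neq0_adj f j k : qaut_proj f != 0 -> e (f j) (f k) = e j k.
Proof.
move=> /eqP f0; apply/eqP; apply: contra_notT f0 => fjk.
rewrite -(qaut_proj_absorb f k) -(qaut_proj_absorb f j) mulrA.
rewrite vcomm (qaut_adj0 vrel) ?mul0r//.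
Qed.

(** The projection [qaut_proj] of a graph automorphism. *)
Definition gproj (s : G) : B := qaut_proj (sgval s : 'S_n).

Lemma gproj_orthogonal (s t : G) : s != t -> gproj s * gproj t = 0.
Proof. by move=> /subg_neqP[j]; exact: qaut_proj_orthogonal. Qed.

(** Expanding the product over [j] of the column sums [\sum_i v i j = 1] gives
    the sum of [qaut_proj f] over all maps [f]. *)
Lemma sum_gproj : \sum_s gproj s = 1.
Proof.
pose h (s : G) : {ffun 'I_n -> 'I_n} := [ffun j => (sgval s : 'S_n) j].
have h_inj : injective h.
  move=> s t /ffunP st; apply/val_inj/permP => j.
  by have := st j; rewrite !ffunE.
have -> : 1 = \sum_(f : {ffun 'I_n -> 'I_n}) qaut_proj f.
  rewrite -[LHS](_ : \prod_(j < n) \sum_i v i j = 1); last first.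
    by rewrite big1 // => j _; exact: qaut_col_sum vrel j.
  exact: bigA_distr_bigA.
rewrite (bigID (mem (h @: [set: G])))/= [X in _ + X]big1 ?addr0 => [|f].
  rewrite big_imset /=; last by move=> ? ? _ _; exact: h_inj.
  apply: eq_big => [s|s _]; first by rewrite in_setT.
  by apply: eq_qaut_proj => j; rewrite ffunE.
move=> fG; apply/eqP; apply: contraR fG => f0.
have sG : perm (qaut_proj_neq0_inj f0) \in Gaut e.
  by apply/mem_GautP => i j; rewrite !permE qaut_proj_neq0_adj.
apply/imsetP; exists (subg _ (perm (qaut_proj_neq0_inj f0))).
  by rewrite in_setT.
by apply/ffunP => j; rewrite ffunE subgK// permE.
Qed.

(** The homomorphism from the function algebra of the classical automorphism
    group sending the fundamental matrix to [v]. *)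
Definition cfun_lift (f : C) : B := \sum_s f s *: gproj s.

Fact cfun_lift_is_linear : linear cfun_lift.
Proof.
move=> a f g; rewrite /cfun_lift scaler_sumr -big_split/=.
by apply: eq_bigr => s _; rewrite !ffunE scalerDl scalerA.
Qed.

HB.instance Definition _ := GRing.isLinear.Build R[i]%C C B *:%R
  cfun_lift cfun_lift_is_linear.

Fact cfun_lift_is_monoid_morphism : monoid_morphism cfun_lift.
Proof.
split=> [|f g].
  rewrite /cfun_lift -sum_gproj; apply: eq_bigr => s _.
  by rewrite ffunE scale1r.
rewrite /cfun_lift mulr_suml; apply: eq_bigr => s _.
rewrite mulr_sumr (bigD1 s)//= big1 => [|t ts]; last first.
  by rewrite -scalerAl -scalerAr gproj_orthogonal 1?eq_sym// !scaler0.
rewrite addr0 -scalerAl -scalerAr scalerA {2}/gproj [gproj s * _]qaut_proj_idem.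
by rewrite ffunE.
Qed.

HB.instance Definition _ := GRing.isMonoidMorphism.Build C B
  cfun_lift cfun_lift_is_monoid_morphism.

Definition cfun_lift_lrmorphism : {lrmorphism C -> B} := cfun_lift.

Lemma cfun_lift_star_hom_on :
  star_hom_on (Gaut_fundamental R e) v cfun_lift.
Proof.
split=> [f|i j] /=.
  rewrite /cfun_lift star_sum; apply: eq_bigr => s _.
  by rewrite starZ star_qaut_proj ffunE.
rewrite /cfun_lift -[RHS]mulr1 -sum_gproj mulr_sumr; apply: eq_bigr => s _.
rewrite mul_entry_qaut_proj !mxE !ffunE.
by case: eqP; rewrite ?mul1r ?mul0r ?scale1r ?scale0r.
Qed.

End Projections.

Lemma cfun_mulC : commutative (@GRing.mul C).
Proof. by move=> f g; apply/ffunP => s; rewrite !ffunE [LHS]mulrC. Qed.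

(** For the fundamental matrix, [gproj s] is the indicator function of [s]. *)
Lemma gproj_fundamental (s t : G) :
  gproj (Gaut_fundamental R e) s t = (s == t)%:R.
Proof.
have [->|st] := eqVneq s t.
  rewrite /gproj /qaut_proj.
  elim/big_ind : _ => [|f g f1 g1|j _]; first by rewrite ffunE.
    by rewrite ffunE f1 g1 [LHS]mulr1.
  by rewrite mxE ffunE eqxx.
have [j stj] := subg_neqP st.
have /(congr1 (fun f : C => f t)) := qaut_proj_absorb
  (Gaut_fundamental_relations R e) (fun i j k l => cfun_mulC _ _)
  (sgval s : 'S_n) j.
by rewrite /gproj => <-; rewrite ffunE mxE ffunE (negPf stj) [LHS]mul0r.
Qed.

Lemma cfun_decomp (f : C) :
  f = \sum_s f s *: gproj (Gaut_fundamental R e) s.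
Proof.
apply/ffunP => t; rewrite sum_ffunE (bigD1 t)//= big1 => [|s st].
  by rewrite addr0 ffunE gproj_fundamental eqxx [RHS]mulr1.
by rewrite ffunE gproj_fundamental (negPf st) [LHS]mulr0.
Qed.

Lemma cfun_lift_unique (B : cstarAlgType R) (v : 'M[B]_n)
    (psi : {lrmorphism C -> B}) :
  star_hom_on (Gaut_fundamental R e) v psi -> psi =1 cfun_lift v.
Proof.
move=> [_ psi_v] f; rewrite {1}(cfun_decomp f) linear_sum.
apply: eq_bigr => s _; rewrite linearZ /=; congr (_ *: _).
by rewrite /gproj /qaut_proj rmorph_prod; apply: eq_bigr => j _; exact: psi_v.
Qed.

Lemma cfun_generated : cstar_generated (Gaut_fundamental R e).
Proof.
move=> S [S1 SD SZ SM _ _] Su; rewrite -classical_sets.subTset => f _.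
rewrite (cfun_decomp f); elim/big_ind : _ => // [|s _].
  by rewrite -(scale0r 1); exact: SZ.
by apply: SZ; rewrite /gproj /qaut_proj; elim/big_ind : _.
Qed.

Hypothesis entries_comm : forall (B : cstarAlgType R) (v : 'M[B]_n),
  qaut_relations e v -> forall i j k l, GRing.comm (v i j) (v k l).

Theorem cfun_is_qaut_algebra : is_qaut_algebra e (Gaut_fundamental R e).
Proof.
split; [exact: Gaut_fundamental_relations|exact: cfun_generated|].
move=> B v vrel; exists (cfun_lift_lrmorphism vrel (entries_comm vrel)).
  exact: (cfun_lift_star_hom_on vrel (entries_comm vrel)).
exact: cfun_lift_unique.
Qed.

Theorem qaut_algebra_iso_cfun (A : cstarAlgType R) (u : 'M[A]_n) :
    is_qaut_algebra e u ->
  exists2 phi : {lrmorphism A -> C},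
    star_hom_on u (Gaut_fundamental R e) phi & bijective phi.
Proof.
move=> [urel _ univ].
have [phi phi_u _] := univ _ _ (Gaut_fundamental_relations R e).
pose psi := cfun_lift_lrmorphism urel (entries_comm urel).
have psi_u : star_hom_on (Gaut_fundamental R e) u psi.
  exact: (cfun_lift_star_hom_on urel (entries_comm urel)).
exists phi => //; exists psi => [x|f].
  (* The identity and [psi \o phi] both fix the entries of [u]. *)
  have [id_A _ id_uniq] := univ _ _ urel.
  have idE : id x = id_A x.
    by apply: (id_uniq (idfun : {lrmorphism A -> A})); split.
  rewrite [RHS]idE; apply: (id_uniq (psi \o phi : {lrmorphism A -> A})).
  split=> [y|i j] /=; first by rewrite phi_u.1 psi_u.1.
  by rewrite phi_u.2 psi_u.2.
rewrite [in RHS](cfun_decomp f) /= /cfun_lift linear_sum.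
apply: eq_bigr => s _; rewrite linearZ /=; congr (_ *: _).
by rewrite /gproj /qaut_proj rmorph_prod; apply: eq_bigr => j _; exact: phi_u.2.
Qed.

Theorem commuting_no_quantum_symmetry : no_quantum_symmetry R e.
Proof.
move=> A u /qaut_algebra_iso_cfun[phi _ /bij_inj phi_inj] x y.
by apply: phi_inj; rewrite !rmorphM [LHS]cfun_mulC.
Qed.

End Commuting.

(** * The Petersen graph *)

Definition Z5_enum : seq 'Z_5 := [:: 0; 1; 2; 3; 4].

Lemma mem_Z5_enum (a : 'Z_5) : a \in Z5_enum.
Proof. by case: a => [[|[|[|[|[|?]]]]] lt5]. Qed.

Definition petersen_enum : seq petersen_vertex :=
  [seq inl k | k <- Z5_enum] ++ [seq inr k | k <- Z5_enum].

Lemma mem_petersen_enum (x : petersen_vertex) : x \in petersen_enum.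
Proof.
rewrite mem_cat; case: x => k; apply/orP; [left|right];
  by apply/mapP; exists k; rewrite ?mem_Z5_enum.
Qed.

Lemma all_petersen (P : pred petersen_vertex) :
  all P petersen_enum -> forall x, P x.
Proof. by move=> /allP P_enum x; apply: P_enum; exact: mem_petersen_enum. Qed.

Lemma all_Z5 (P : pred 'Z_5) : all P Z5_enum -> forall a, P a.
Proof. by move=> /allP P_enum a; apply: P_enum; exact: mem_Z5_enum. Qed.

Lemma petersen_sym : symmetric petersen_adj.
Proof.
move=> x y; apply/eqP; move: y; apply: all_petersen; move: x.
by apply: all_petersen; vm_compute.
Qed.

Lemma petersen_no_quad x y z t : x != y -> petersen_adj z x ->
  petersen_adj z y -> petersen_adj t x -> petersen_adj t y -> z = t.
Proof.
pose A := petersen_adj.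
have : (x != y) ==> A z x ==> A z y ==> A t x ==> A t y ==> (z == t).
  move: t; apply: all_petersen; move: z; apply: all_petersen.
  move: y; apply: all_petersen; move: x; apply: all_petersen.
  by vm_compute.
by do 5!(move=> /implyP/[apply]); move/eqP.
Qed.

Lemma petersen_common_nbr x y : x != y -> ~~ petersen_adj x y ->
  exists2 z, petersen_adj x z & petersen_adj z y.
Proof.
have : (x != y) ==> ~~ petersen_adj x y ==>
    has (fun z => petersen_adj x z && petersen_adj z y) petersen_enum.
  move: y; apply: all_petersen; move: x; apply: all_petersen.
  by vm_compute.
do 2!(move=> /implyP/[apply]).
by move=> /hasP[z _ /andP[xz zy]]; exists z.
Qed.

Lemma petersen_subcubic x y0 y1 y2 y3 : uniq [:: y0; y1; y2] ->
  all (petersen_adj x) [:: y0; y1; y2; y3] -> y3 \in [:: y0; y1; y2].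
Proof.
move=> uniq_y /allP adj_y.
have /eqP nbr3 : size (filter (petersen_adj x) petersen_enum) == 3%N.
  by move: x {adj_y}; apply: all_petersen; vm_compute.
have sub : {subset [:: y0; y1; y2] <= filter (petersen_adj x) petersen_enum}.
  move=> y y_in; rewrite mem_filter mem_petersen_enum andbT adj_y//.
  by move: y_in; rewrite !inE => /or3P[] ->; rewrite ?orbT.
have [//|_ eq_y] := uniq_min_size uniq_y sub _; first by rewrite nbr3.
by rewrite eq_y mem_filter mem_petersen_enum andbT adj_y// !inE eqxx !orbT.
Qed.

(** * The automorphism group of the Petersen graph *)

(** The labelling of the Petersen graph by the pairs of elements of Z/5, two
    vertices being adjacent when their pairs are disjoint.  The pair of a vertex
    is ordered in an arbitrary way. *)
Definition pair_of (x : petersen_vertex) : 'Z_5 * 'Z_5 :=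
  match x with
  | inl k => (2 * k, 2 * k + 1)
  | inr k => (2 * k + 2, 2 * k + 4)
  end.

(** The vertex labelled by the unordered pair of [a] and [b]; the value is
    meaningless when [a = b].  As 3 is the inverse of 2 modulo 5, [3 * a] solves
    [2 * k = a] and [3 * a + 4] solves [2 * k + 2 = a]. *)
Definition vertex_of (a b : 'Z_5) : petersen_vertex :=
  if b == a + 1 then inl (3 * a) else
  if a == b + 1 then inl (3 * b) else
  if b == a + 2 then inr (3 * a + 4) else inr (3 * b + 4).

Lemma pair_ofK x : vertex_of (pair_of x).1 (pair_of x).2 = x.
Proof. by apply/eqP; move: x; apply: all_petersen; vm_compute. Qed.

Lemma pair_of_neq x : (pair_of x).1 != (pair_of x).2.
Proof. by move: x; apply: all_petersen; vm_compute. Qed.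

Lemma vertex_ofC a b : a != b -> vertex_of a b = vertex_of b a.
Proof.
have : (a != b) ==> (vertex_of a b == vertex_of b a).
  by move: b; apply: all_Z5; move: a; apply: all_Z5; vm_compute.
by move=> /implyP/[apply]/eqP.
Qed.

Lemma pair_of_vertex_of a b : a != b ->
  pair_of (vertex_of a b) = (a, b) \/ pair_of (vertex_of a b) = (b, a).
Proof.
have : (a != b) ==> ((pair_of (vertex_of a b) == (a, b)) ||
                     (pair_of (vertex_of a b) == (b, a))).
  by move: b; apply: all_Z5; move: a; apply: all_Z5; vm_compute.
by move=> /implyP/[apply]/orP[]/eqP; [left|right].
Qed.

Lemma petersen_adj_vertex_of a b c d : a != b -> c != d ->
  petersen_adj (vertex_of a b) (vertex_of c d) =
  [&& a != c, a != d, b != c & b != d].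
Proof.
have : (a != b) ==> (c != d) ==>
    (petersen_adj (vertex_of a b) (vertex_of c d) ==
     [&& a != c, a != d, b != c & b != d]).
  move: d; apply: all_Z5; move: c; apply: all_Z5.
  by move: b; apply: all_Z5; move: a; apply: all_Z5; vm_compute.
by do 2!(move=> /implyP/[apply]); move/eqP.
Qed.

(** The right action of S_5 on the vertices, through their labels. *)
Definition vertex_act (s : 'S_5) (x : petersen_vertex) : petersen_vertex :=
  vertex_of (s (pair_of x).1) (s (pair_of x).2).

Lemma vertex_act_of s a b : a != b ->
  vertex_act s (vertex_of a b) = vertex_of (s a) (s b).
Proof.
move=> ab; rewrite /vertex_act; case: (pair_of_vertex_of ab) => -> //=.
by rewrite vertex_ofC// (inj_eq perm_inj) eq_sym.
Qed.

Lemma vertex_actM s t x :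
  vertex_act (s * t)%g x = vertex_act t (vertex_act s x).
Proof.
rewrite [vertex_act s x]/vertex_act vertex_act_of; last first.
  by rewrite (inj_eq perm_inj) pair_of_neq.
by rewrite /vertex_act !permM.
Qed.

Lemma vertex_act1 x : vertex_act 1%g x = x.
Proof. by rewrite /vertex_act !perm1 pair_ofK. Qed.

Lemma vertex_act_adj s x y :
  petersen_adj (vertex_act s x) (vertex_act s y) = petersen_adj x y.
Proof.
rewrite -[in RHS](pair_ofK x) -[in RHS](pair_ofK y).
by rewrite !petersen_adj_vertex_of ?(inj_eq perm_inj) ?pair_of_neq.
Qed.

(** An element [a] is the intersection of two pairs, which are both fixed. *)
Lemma vertex_act_faithful s : (forall x, vertex_act s x = x) -> s = 1%g.
Proof.
move=> s_triv.
have s_pair (a b : 'Z_5) : a != b -> s a \in [:: a; b].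
  move=> ab; have := s_triv (vertex_of a b); rewrite vertex_act_of// => sab.
  have sasb : s a != s b by rewrite (inj_eq perm_inj).
  rewrite !inE.
  case: (pair_of_vertex_of ab) (pair_of_vertex_of sasb); rewrite sab => ->.
    by case=> [[sa _]|[_ sa]]; rewrite -sa eqxx ?orbT.
  by case=> [[sa _]|[_ sa]]; rewrite -sa eqxx ?orbT.
apply/permP => a; rewrite perm1; apply/eqP.
have third (b : 'Z_5) : has (fun c => (c != a) && (c != b)) Z5_enum.
  by move: b; apply: all_Z5; move: (a : 'Z_5); apply: all_Z5; vm_compute.
have /hasP[b _ /andP[ba _]] := third a.
have /hasP[c _ /andP[ca cb]] := third b.
have := s_pair a b; have := s_pair a c; rewrite !inE ![a == _]eq_sym ca ba.
move=> /(_ isT)/orP[//|/eqP ->] /(_ isT)/orP[//|/eqP cb'].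
by rewrite cb' eqxx in cb.
Qed.

(** The directed paths with three edges, that is, the 3-arcs. *)
Definition petersen_arcs : seq (petersen_vertex * petersen_vertex *
                                petersen_vertex * petersen_vertex) :=
  let nbr x := filter (petersen_adj x) petersen_enum in
  flatten [seq flatten [seq flatten [seq [seq (x, y, z, t) |
    t <- nbr z & t != y] | z <- nbr y & z != x] | y <- nbr x] |
    x <- petersen_enum].

Lemma size_petersen_arcs : size petersen_arcs = 120%N.
Proof. by vm_compute. Qed.

Lemma mem_petersen_arcs x y z t :
    petersen_adj x y -> petersen_adj y z -> petersen_adj z t ->
    z != x -> t != y ->
  (x, y, z, t) \in petersen_arcs.
Proof.
move=> xy yz zt zx ty.
apply/flatten_mapP; exists x; first exact: mem_petersen_enum.
apply/flatten_mapP; exists y; first by rewrite mem_filter xy mem_petersen_enum.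
apply/flatten_mapP; exists z.
  by rewrite !mem_filter zx yz mem_petersen_enum.
by apply/map_f; rewrite !mem_filter ty zt mem_petersen_enum.
Qed.

(** The vertex [inl 4] is the common neighbour of [inl 0] and [inl 3], and
    [inr k] is the third neighbour of [inl k]. *)
Lemma petersen_aut_eq (F G : petersen_vertex -> petersen_vertex) :
    injective F -> injective G ->
    {mono F : x y / petersen_adj x y} -> {mono G : x y / petersen_adj x y} ->
    {in [:: inl 0; inl 1; inl 2; inl 3], F =1 G} ->
  F =1 G.
Proof.
move=> F_inj G_inj F_adj G_adj FG.
have FGo k : F (inl k) = G (inl k).
  have := mem_Z5_enum k; rewrite !inE.
  case/or4P=> [/eqP->|/eqP->|/eqP->|/orP[]/eqP->]; try by apply: FG.
  apply: (@petersen_no_quad (F (inl 0)) (F (inl 3))); rewrite ?F_adj//.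
  - by rewrite (inj_eq F_inj).
  - by rewrite FG// G_adj.
  - by rewrite FG// G_adj.
case=> // k.
have nbrs : uniq [:: inl (k + 1); inl (k - 1); inr k] &&
    all (petersen_adj (inl k)) [:: inl (k + 1); inl (k - 1); inr k].
  by move: k; apply: all_Z5; vm_compute.
have /andP[nbrs_uniq /and4P[adj1 adj2 adj3 _]] := nbrs.
have: G (inr k) \in [:: F (inl (k + 1)); F (inl (k - 1)); F (inr k)].
  apply: (@petersen_subcubic (F (inl k))).
    by rewrite (map_inj_uniq F_inj [:: inl (k + 1); inl (k - 1); inr k]).
  by rewrite /= !F_adj adj1 adj2 adj3 FGo G_adj adj3.
by rewrite !FGo !inE !(inj_eq G_inj) /= => /eqP.
Qed.

Section Automorphisms.
Variables (lab : 'I_10 -> petersen_vertex) (unlab : petersen_vertex -> 'I_10).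
Hypotheses (labK : cancel lab unlab) (unlabK : cancel unlab lab).
Local Notation e := (relpre lab petersen_adj : rel 'I_10).

Lemma card_petersen_aut : (#|Gaut e| <= 120)%N.
Proof.
pose hat (s : 'S_10) x := lab (s (unlab x)).
have hat_inj s : injective (hat s).
  by move=> x y /(can_inj labK)/perm_inj/(can_inj unlabK).
have hat_adj s : s \in Gaut e -> {mono hat s : x y / petersen_adj x y}.
  move=> /mem_GautP s_aut x y; have := s_aut (unlab x) (unlab y).
  by rewrite /= !unlabK.
pose arc s := (hat s (inl 0), hat s (inl 1), hat s (inl 2), hat s (inl 3)).
have arc_inj : {in Gaut e &, injective arc}.
  move=> s t sG tG [st0 st1 st2 st3].
  have /= st : hat s =1 hat t.
    apply: petersen_aut_eq; [exact: hat_inj|exact: hat_inj|exact: hat_adj..|].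
    by move=> x; rewrite !inE => /or4P[]/eqP->.
  apply/permP => i; apply: (can_inj labK).
  by have := st (lab i); rewrite /hat !labK.
have arcP a : a \in arc @: Gaut e -> a \in petersen_arcs.
  move=> /imsetP[s sG ->].
  by rewrite mem_petersen_arcs ?(hat_adj s sG) ?(inj_eq (@hat_inj s)).
rewrite -(card_in_imset arc_inj).
(* The list is made opaque, lest unification evaluate it. *)
move: petersen_arcs size_petersen_arcs arcP => arcs arcs_size arcP.
have /subset_leq_card/leq_trans := introT subsetP arcP; apply.
by rewrite (leq_trans (card_size arcs)) ?arcs_size.
Qed.

Fact label_act_inj (s : 'S_5) :
  injective (fun i => unlab (vertex_act s (lab i))).
Proof.
move=> i j /(can_inj unlabK)/(congr1 (vertex_act s^-1%g)).
by rewrite -!vertex_actM mulgV !vertex_act1 => /(can_inj labK).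
Qed.

(** The action of S_5 carried over to ['I_10] by the relabelling. *)
Definition label_perm (s : 'S_5) : 'S_10 := perm (@label_act_inj s).

Fact label_permM : {in [set: 'S_5] &, {morph label_perm : s t / (s * t)%g}}.
Proof.
move=> s t _ _; apply/permP => i.
by rewrite permM !permE unlabK vertex_actM.
Qed.

Canonical label_perm_morphism := Morphism label_permM.

Theorem petersen_aut_isog : Gaut e \isog [set: 'S_5].
Proof.
have injf : ('injm label_perm_morphism)%g.
  apply/injmP => s t _ _ /permP st; apply/eqP; rewrite eq_mulVg1; apply/eqP.
  apply: vertex_act_faithful => x.
  have := st (unlab (vertex_act s^-1%g x)).
  rewrite !permE !unlabK -!vertex_actM mulVg vertex_act1.
  by move=> /(can_inj unlabK) <-.
rewrite isog_sym; apply/isogP; exists label_perm_morphism => //=.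
apply/eqP; rewrite eqEcard card_injm// cardsT card_Sn.
rewrite (leq_trans card_petersen_aut) ?andbT//.
apply/subsetP => _ /morphimP[s _ _ ->]; apply/mem_GautP => i j.
by rewrite /= !permE !unlabK vertex_act_adj.
Qed.

End Automorphisms.

(** * Quantum symmetry of the Petersen graph *)

Theorem theorem3p3 (R : realType) (lab : 'I_10 -> petersen_vertex)
    (lab_bij : bijective lab) :
  let e : rel 'I_10 := relpre lab petersen_adj in
  [/\ exists (A : cstarAlgType R) (u : 'M[A]_10), is_qaut_algebra e u,
      no_quantum_symmetry R e,
      forall (A : cstarAlgType R) (u : 'M[A]_10), is_qaut_algebra e u ->
        exists2 phi : {lrmorphism A -> cfun R (subg_of (Gaut e))},
          star_hom_on u (Gaut_fundamental R e) phi & bijective phi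
    & Gaut e \isog [set: 'S_5] ].
Proof.
move=> e; have [unlab labK unlabK] := lab_bij.
have entries_comm (B : cstarAlgType R) (v : 'M[B]_10) :
    qaut_relations e v -> forall i j k l, GRing.comm (v i j) (v k l).
  move=> vrel; apply: (qaut_entries_comm vrel) =>
    [x y z t|x y|x y|x y0 y1 y2 y3].
  - rewrite -(inj_eq (can_inj labK)) => xy zx zy tx ty.
    exact/(can_inj labK)/(petersen_no_quad xy).
  - exact: petersen_sym.
  - rewrite -(inj_eq (can_inj labK)) => /petersen_common_nbr/[apply] -[z xz zy].
    by exists (unlab z); rewrite /e /= unlabK.
  - rewrite -(map_inj_uniq (can_inj labK)) => y_uniq y_adj.
    rewrite -(mem_map (can_inj labK)).
    exact: (petersen_subcubic (x := lab x) y_uniq).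
split.
- exists (cfun R (subg_of (Gaut e))), (Gaut_fundamental R e).
  exact: cfun_is_qaut_algebra.
- exact: commuting_no_quantum_symmetry.
- exact: qaut_algebra_iso_cfun.
- exact: petersen_aut_isog labK unlabK.
Qed.
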